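(* Let $\varepsilon>0$, let $\mathcal{T}=(a,b,c)$ be a parity-class triple with $K=(a+b)/2>1$, and put $s=\min\{a,b\}$ and $\theta_\varepsilon=\varepsilon/(1+\varepsilon)$. Then $$E_\varepsilon(\mathcal{T})\ge 0\quad\Longleftrightarrow\quad \delta_{\mathrm{lin}}(\mathcal{T})\ \ge\ t^{\mathcal K}(\mathcal{T})+\theta_\varepsilon\log(2K)+\log\Bigl(s\Bigl(2-\frac sK\Bigr)\Bigr).$$ The boundary term satisfies $$\log\Bigl(2-\frac1K\Bigr)\le \log\Bigl(s\Bigl(2-\frac sK\Bigr)\Bigr)\le \log(2s),$$ and, for fixed $K$, the function $s\mapsto\log\bigl(s(2-s/K)\bigr)$ is increasing on $[1,K]$, so that its least value occurs at $s=1$.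
   Context: A parity-class triple is a triple $\mathcal{T}=(a,b,c)$ of pairwise coprime positive integers with $a+b=c$, $a$ and $b$ odd, and $c$ even. Put $K=(a+b)/2$, so $c=2K$. For a positive integer $n$, $\mathrm{rad}(n)$ is the product of the distinct primes dividing $n$, and $\log$ is the natural logarithm. The radical excess is $E_\varepsilon(\mathcal{T})=\log c-(1+\varepsilon)\log\mathrm{rad}(abc)$. The linear defect is $\delta_{\mathrm{lin}}(\mathcal{T})=\log\bigl(ab/(\mathrm{rad}(a)\,\mathrm{rad}(b))\bigr)$. Moreover $R_{\mathcal K}(\mathcal{T})=\prod_{p\mid K,\ p\text{ odd prime}}p$ and $t^{\mathcal K}(\mathcal{T})=\log R_{\mathcal K}(\mathcal{T})$. *)

(* Defs.v *)
From HB Require Import structures.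
From mathcomp Require Import all_boot all_order all_algebra.
From mathcomp Require Import reals exp.
Set Implicit Arguments.
Unset Strict Implicit.
Unset Printing Implicit Defensive.
Import Order.TTheory GRing.Theory Num.Theory.

Local Open Scope nat_scope.

Record parity_triple := ParityTriple {
  ta : nat;
  tb : nat;
  tc : nat;
  ta_gt0 : 0 < ta;
  tb_gt0 : 0 < tb;
  tc_gt0 : 0 < tc;
  coprime_ab : coprime ta tb;
  coprime_ac : coprime ta tc;
  coprime_bc : coprime tb tc;
  addn_ab : ta + tb = tc;
  odd_a : odd ta;
  odd_b : odd tb;
  even_c : ~~ odd tc
}.

(* The halving in [tK] is exact. *)
Definition tK (T : parity_triple) : nat := (ta T + tb T)./2.

Lemma tcE (T : parity_triple) : tc T = 2 * tK T.
Proof. by rewrite /tK addn_ab mul2n even_halfK // even_c. Qed.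

Definition rad (n : nat) : nat := \prod_(p <- primes n) p.

Definition RK (T : parity_triple) : nat :=
  \prod_(p <- primes (tK T) | odd p) p.

Local Open Scope ring_scope.

Definition radical_excess (R : realType) (eps : R) (T : parity_triple) : R :=
  ln (tc T)%:R - (1 + eps) * ln (rad (ta T * tb T * tc T)%N)%:R.

Definition linear_defect (R : realType) (T : parity_triple) : R :=
  ln ((ta T)%:R * (tb T)%:R / ((rad (ta T))%:R * (rad (tb T))%:R)).

Definition tKlog (R : realType) (T : parity_triple) : R := ln (RK T)%:R.

Definition boundary_term (R : realType) (K : nat) (s : R) : R :=
  ln (s * (2 - s / K%:R)).

Arguments linear_defect : clear implicits.
Arguments tKlog : clear implicits.

(* Main.v *)
Require Import Defs.
From HB Require Import structures.
From mathcomp Require Import all_boot all_order all_algebra.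
From mathcomp Require Import reals exp.
From mathcomp Require Import ring lra zify.
Set Implicit Arguments.
Unset Strict Implicit.
Unset Printing Implicit Defensive.
Import Order.TTheory GRing.Theory Num.Theory.
Local Open Scope ring_scope.

(** Two identities turn both sides of the equivalence into the same linear
    inequality between logarithms.

    Since [a], [b], [c] are pairwise coprime and [c = 2 K], the radical splits
    as [rad (a b c) = rad a * rad b * (2 * RK)], the factor [2] being always
    present because [c] is even ([rad_abc]).  Since [{a, b} = {s, 2 K - s}], the
    product satisfies [a b = K * (s (2 - s / K))], so the boundary term is
    exactly [ln (a b) - ln K] ([ab_boundary]).  The boundary terms on the two
    sides of the second inequality therefore cancel, leaving
    [ln rad (a b c) <= (1 - theta) ln (2 K)]; as [1 - theta = 1 / (1 + eps)],
    multiplying by [1 + eps] gives the nonnegativity of the radical excess.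

    The monotonicity claims come from the factorization
    [y (2 - y / K) - x (2 - x / K) = (y - x) (2 - (x + y) / K)], whose second
    factor is positive for [x < y <= K] ([boundary_arg_lt]).  Since
    [1 <= s <= K], monotonicity yields the lower bound [ln (2 - 1 / K)], which
    is the value at [s = 1]; the upper bound only drops the term [s / K >= 0]. *)

(* The radical of an integer, as opposed to the radical of a bilinear form. *)
Local Notation rad := Defs.rad.

Lemma rad_gt0 (n : nat) : (0 < rad n)%N.
Proof.
rewrite /rad big_seq; apply: prodn_cond_gt0 => p.
by rewrite mem_primes => /andP[/prime_gt0].
Qed.

Lemma rad_coprimeM (m n : nat) :
  (0 < m)%N -> (0 < n)%N -> coprime m n -> rad (m * n) = (rad m * rad n)%N.
Proof.
move=> m0 n0 mn; rewrite /rad -big_cat; apply: perm_big.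
apply: uniq_perm; first exact: primes_uniq.
  rewrite cat_uniq !primes_uniq andbT /=.
  by rewrite coprime_has_primes in mn.
by move=> p; rewrite mem_cat primesM.
Qed.

(** The prime [2] divides [2 K] whether or not it divides [K], so only the odd
    part of the prime support of [K] matters. *)
Lemma rad_double (K : nat) :
  (0 < K)%N -> rad (2 * K) = (2 * \prod_(p <- primes K | odd p) p)%N.
Proof.
move=> K0; rewrite /rad.
transitivity (\prod_(p <- 2 :: [seq p <- primes K | odd p]) p)%N;
  last by rewrite big_cons big_filter.
apply: perm_big; apply: uniq_perm; first exact: primes_uniq.
  by rewrite /= filter_uniq ?primes_uniq // mem_filter.
move=> p; rewrite primesM // !inE mem_filter /= mem_primes.
have [//|p2 /=] := eqVneq p 2%N.
case: (boolP (prime p)) => [pp|_]; last by rewrite andbF.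
by case: (even_prime pp) => [p2'|->] //; rewrite p2' in p2.
Qed.

Lemma tK_gt0 (T : parity_triple) : (0 < tK T)%N.
Proof. by have := tc_gt0 T; rewrite tcE; lia. Qed.

Lemma rad_abc (T : parity_triple) :
  rad (ta T * tb T * tc T) = (rad (ta T) * rad (tb T) * (2 * RK T))%N.
Proof.
have [[a0 b0] c0] := (ta_gt0 T, tb_gt0 T, tc_gt0 T).
rewrite !rad_coprimeM ?muln_gt0 ?a0 ?b0 ?coprimeMl ?coprime_ab //.
  by rewrite [tc T]tcE rad_double ?tK_gt0.
by rewrite coprime_ac coprime_bc.
Qed.

Lemma RK_gt0 (T : parity_triple) : (0 < RK T)%N.
Proof.
have := rad_gt0 (2 * tK T); rewrite rad_double ?tK_gt0 // -/(RK T).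
by rewrite muln_gt0.
Qed.

Lemma min_ab_gt0 (T : parity_triple) : (0 < minn (ta T) (tb T))%N.
Proof. by rewrite leq_min ta_gt0 tb_gt0. Qed.

Lemma min_ab_leK (T : parity_triple) : (minn (ta T) (tb T) <= tK T)%N.
Proof. by have := addn_ab T; rewrite tcE; lia. Qed.

Section Boundary.
Variable R : realType.

(** The larger of [a] and [b] is [2 K - s], because [a + b = 2 K]; factoring
    [K] out of [s (2 K - s)] isolates the argument of the boundary term. *)
Lemma ab_boundary (T : parity_triple) (s := minn (ta T) (tb T)) :
  (ta T)%:R * (tb T)%:R =
  (tK T)%:R * (s%:R * (2 - s%:R / (tK T)%:R)) :> R.
Proof.
have K0 : (tK T)%:R != 0 :> R by rewrite pnatr_eq0 -lt0n tK_gt0.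
have abK : (ta T)%:R + (tb T)%:R = 2 * (tK T)%:R :> R.
  by rewrite -natrD addn_ab tcE natrM.
transitivity (s%:R * (2 * (tK T)%:R - s%:R) : R); last by field.
by rewrite -abK /s; case: leqP => _; ring.
Qed.

Lemma boundary_arg_lt (K x y : R) : 0 < K -> x < y -> y <= K ->
  x * (2 - x / K) < y * (2 - y / K).
Proof.
move=> K0 xy yK; rewrite -subr_gt0.
have -> : y * (2 - y / K) - x * (2 - x / K) = (y - x) * (2 * K - (x + y)) / K.
  by field; rewrite gt_eqF.
by rewrite divr_gt0 // mulr_gt0; lra.
Qed.

(** Strict monotonicity is also available from [0], where the function vanishes,
    so it yields positivity on the half-open interval from [0] to [K]. *)
Lemma boundary_arg_gt0 (K x : R) : 0 < x -> x <= K -> 0 < x * (2 - x / K).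
Proof.
move=> x0 xK; have := boundary_arg_lt (lt_le_trans x0 xK) x0 xK.
by rewrite mul0r.
Qed.

Lemma boundary_term_lt (K : nat) (x y : R) :
  0 < x -> x < y -> y <= K%:R -> boundary_term K x < boundary_term K y.
Proof.
move=> x0 xy yK; have y0 := lt_trans x0 xy.
rewrite /boundary_term ltr_ln ?posrE ?boundary_arg_gt0 //; last first.
  exact: le_trans (ltW xy) yK.
by apply: boundary_arg_lt => //; exact: lt_le_trans yK.
Qed.

Lemma boundary_term_ge1 (K : nat) (x : R) :
  1 <= x -> x <= K%:R -> boundary_term K 1 <= boundary_term K x.
Proof.
rewrite le_eqVlt => /predU1P[<- //|x1 xK].
exact/ltW/boundary_term_lt.
Qed.

Lemma boundary_term_le (K : nat) (x : R) :
  0 < x -> x <= K%:R -> boundary_term K x <= ln (2 * x).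
Proof.
move=> x0 xK; rewrite /boundary_term ler_ln ?posrE ?boundary_arg_gt0 //.
  by rewrite mulrC ler_pM2r // gerBl divr_ge0 // ltW // (lt_le_trans x0).
by rewrite mulr_gt0.
Qed.

Lemma linear_defectE (T : parity_triple) (s := minn (ta T) (tb T)) :
  linear_defect R T = ln (tK T)%:R + boundary_term (tK T) (s%:R : R)
                      - (ln (rad (ta T))%:R + ln (rad (tb T))%:R).
Proof.
have s0 : 0 < s%:R :> R by rewrite ltr0n min_ab_gt0.
have sK : s%:R <= (tK T)%:R :> R by rewrite ler_nat min_ab_leK.
have B0 := boundary_arg_gt0 s0 sK.
have K0 : 0 < (tK T)%:R :> R by rewrite ltr0n tK_gt0.
have ra0 : 0 < (rad (ta T))%:R :> R by rewrite ltr0n rad_gt0.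
have rb0 : 0 < (rad (tb T))%:R :> R by rewrite ltr0n rad_gt0.
rewrite /linear_defect ab_boundary -/s.
rewrite (ln_div (mulr_gt0 K0 B0) (mulr_gt0 ra0 rb0)).
by rewrite (lnM K0 B0) (lnM ra0 rb0).
Qed.

Lemma ln_rad_abc (T : parity_triple) :
  ln (rad (ta T * tb T * tc T))%:R =
  ln (rad (ta T))%:R + ln (rad (tb T))%:R + (ln 2 + tKlog R T) :> R.
Proof.
by rewrite rad_abc !natrM !lnM ?posrE ?mulr_gt0 ?ltr0n ?rad_gt0 ?RK_gt0.
Qed.

(** The boundary terms cancel, and the difference of the two sides of the
    second inequality becomes [ln (2 K) / (1 + eps) - ln rad (a b c)], that is,
    the radical excess divided by the positive number [1 + eps]. *)
Lemma radical_excess_ge0 (eps : R) (T : parity_triple)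
    (s := minn (ta T) (tb T)) : 0 < eps ->
  (0 <= radical_excess eps T) =
  (tKlog R T + eps / (1 + eps) * ln (2 * (tK T)%:R)
     + boundary_term (tK T) (s%:R : R) <= linear_defect R T).
Proof.
move=> eps0; have e1 : 0 < 1 + eps by lra.
rewrite linear_defectE /radical_excess ln_rad_abc tcE natrM.
rewrite lnM ?posrE ?ltr0n ?tK_gt0 // -[RHS]subr_ge0 -(pmulr_rge0 _ e1).
by congr (0 <= _); field; rewrite gt_eqF.
Qed.

End Boundary.

Theorem theorem4p3 (R : realType) (eps : R) (T : parity_triple)
    (eps_gt0 : 0 < eps) (K_gt1 : (1 < tK T)%N) :
  let K := tK T in
  let s := minn (ta T) (tb T) in
  let theta := eps / (1 + eps) in
  (0 <= radical_excess eps T <->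
     tKlog R T + theta * ln (2 * K%:R) + boundary_term K (s%:R : R)
       <= linear_defect R T) /\
  (ln (2 - 1 / K%:R) <= boundary_term K (s%:R : R) /\
   boundary_term K (s%:R : R) <= ln (2 * s%:R)) /\
  (forall x y : R, 1 <= x -> x < y -> y <= K%:R ->
     boundary_term K x < boundary_term K y) /\
  (forall x : R, 1 <= x -> x <= K%:R ->
     boundary_term K 1 <= boundary_term K x).
Proof.
move=> K s theta.
have s1 : 1 <= s%:R :> R by rewrite ler1n min_ab_gt0.
have sK : s%:R <= K%:R :> R by rewrite ler_nat min_ab_leK.
split; first by rewrite radical_excess_ge0.
split; first split.
- have := boundary_term_ge1 s1 sK.
  by rewrite [in X in X -> _]/boundary_term mul1r.
- by apply: boundary_term_le => //; lra.
split=> [x y x1|]; last exact: boundary_term_ge1.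
by apply: boundary_term_lt; lra.
Qed.
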